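(* Let $A\in\mathbb M(n)$, $1\le k\le n$, and $g(Y)=\|Y\|_{(k)}$. Then $$\partial g(A)=\operatorname{conv}\Big\{\sum_{i=1}^ku_iv_i^*:\ u_1,\dots,u_k\in\mathbb C^n\text{ o.n.},\ v_1,\dots,v_k\in\mathbb C^n\text{ o.n.},\ Av_i=s_i(A)u_i\ \forall\,1\le i\le k\Big\}$$ $$=\operatorname{conv}\Big\{\sum_{i=1}^ku_iv_i^*:\ u_1,\dots,u_k\text{ o.n.},\ v_1,\dots,v_k\text{ o.n.},\ Av_i=s_i(A)u_i,\ A^*u_i=s_i(A)v_i\ \forall\,1\le i\le k\Big\}.$$
   Context: $\mathbb M(n)$ is the real Banach space of $n\times n$ complex matrices, with dual identified with $\mathbb M(n)$ via $G\mapsto(X\mapsto\operatorname{Re}\operatorname{tr}(G^*X))$. The subdifferential of a convex $f:\mathbb M(n)\to\mathbb R$ at $A$ is $\partial f(A)=\{G\in\mathbb M(n): f(Y)-f(A)\ge\operatorname{Re}\operatorname{tr}(G^*(Y-A))\ \forall Y\in\mathbb M(n)\}$. $s_i(A)$ are the singular values in decreasing order, $\|Y\|_{(k)}=\sum_{i=1}^ks_i(Y)$, ''o.n.'' means orthonormal, and $\operatorname{conv}$ denotes convex hull. *)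

(* Defs.v *)
(* Complex scalars: an arbitrary numClosedFieldType C
   (e.g. algC). *)
From HB Require Import structures.
From mathcomp Require Import all_boot all_order all_algebra.
Set Implicit Arguments. Unset Strict Implicit. Unset Printing Implicit Defensive.
Import Order.TTheory GRing.Theory Num.Theory.
Local Open Scope ring_scope.

Section Defs.
Variable C : numClosedFieldType.

(* conjugate transpose X^* *)
Definition adjmx (m p : nat) (X : 'M[C]_(m, p)) : 'M[C]_(p, m) :=
  (map_mx (fun z : C => z^*) X)^T.

(* the real pairing <G, X> = Re tr (G^* X) *)
Definition pairing (n : nat) (G X : 'M[C]_n) : C := 'Re (\tr (adjmx G *m X)).

(* eigenvalues of A^* A, with multiplicity (roots of its characteristic polynomial) *)
Definition gram_eigs (n : nat) (A : 'M[C]_n) : seq C :=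
  sval (closed_field_poly_normal (char_poly (adjmx A *m A))).

(* singular values in decreasing order: square roots of eigenvalues of A^* A *)
Definition sing_vals (n : nat) (A : 'M[C]_n) : seq C :=
  sort (fun x y : C => y <= x) [seq sqrtC z | z <- gram_eigs A].

(* s i A = s_{i+1}(A) in the paper's 1-based indexing *)
Definition sv (n : nat) (i : nat) (A : 'M[C]_n) : C := nth 0 (sing_vals A) i.

(* Ky Fan k-norm ||Y||_(k) = s_1(Y) + ... + s_k(Y) *)
Definition kyfan (n k : nat) (Y : 'M[C]_n) : C := \sum_(i < k) sv i Y.

(* subdifferential of a convex f : M(n) -> R at A *)
Definition subdiff (n : nat) (f : 'M[C]_n -> C) (A : 'M[C]_n) (G : 'M[C]_n) : Prop :=
  forall Y : 'M[C]_n, pairing G (Y - A) <= f Y - f A.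

(* convex hull: finite convex combinations *)
Definition conv (n : nat) (S : 'M[C]_n -> Prop) (G : 'M[C]_n) : Prop :=
  exists (m : nat) (c : 'I_m -> C) (P : 'I_m -> 'M[C]_n),
    [/\ forall j, 0 <= c j, \sum_j c j = 1, forall j, S (P j)
      & G = \sum_j c j *: P j].

(* orthonormal family of column vectors in C^n *)
Definition orthonormal (n k : nat) (u : 'I_k -> 'cV[C]_n) : Prop :=
  forall i j : 'I_k, adjmx (u i) *m u j = (i == j)%:R%:M.

Definition gen1 (n k : nat) (A : 'M[C]_n) (G : 'M[C]_n) : Prop :=
  exists (u v : 'I_k -> 'cV[C]_n),
    [/\ orthonormal u, orthonormal v,
        forall i : 'I_k, A *m v i = sv i A *: u i
      & G = \sum_(i < k) u i *m adjmx (v i)].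

Definition gen2 (n k : nat) (A : 'M[C]_n) (G : 'M[C]_n) : Prop :=
  exists (u v : 'I_k -> 'cV[C]_n),
    [/\ orthonormal u, orthonormal v,
        forall i : 'I_k, A *m v i = sv i A *: u i /\ adjmx A *m u i = sv i A *: v i
      & G = \sum_(i < k) u i *m adjmx (v i)].
End Defs.

(* Main.v *)
(* Write [s] for the singular values of [A], [A = P diag(s) Q^H]
   ([^H] being the adjoint).  For [n x k] isometries [X], [Y] put [M = X^H P],
   [N = Y^H Q]; then
   [Re tr((X Y^H)^H A) = sum_j s_j Re <M_j, N_j>], and since the squared column
   norms of [M] and [N] lie in [0, 1] and sum to [k], this is at most
   [s_1 + ... + s_k].  Equality forces [M_j = N_j] where [s_j > 0],
   [|M_j| = |N_j| = 1] where [s_j > s_k] and [M_j = N_j = 0] where [s_j < s_k];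
   completing the columns [M_j] with [s_j > s_k] to a unitary [W], the columns of
   [X W] and [Y W] are the required singular vectors of [A].

   The hard inclusion avoids separation theorems (the real part of [C] need not be
   complete).  A subgradient [G] satisfies [Re tr(G^H A) = g(A)] and
   [Re tr(G^H Y) <= g(Y)] for all [Y]; testing on matrices sharing the singular
   vectors of [G = X diag(d) Y^H] gives [d_j <= 1] and [sum_j d_j <= k].  Such a [d]
   is a convex combination of vectors in [{-1, 0, 1}^n] with exactly [k] nonzero
   entries, so [G] is a convex combination of matrices [X' Y'^H] with [n x k]
   isometries [X'], [Y'], and those carrying positive weight attain
   equality against [A]. *)
Require Import Defs.
From HB Require Import structures.
From mathcomp Require Import all_boot all_order all_algebra.
From mathcomp Require Import perm spectral ring.
Set Implicit Arguments.
Unset Strict Implicit.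
Unset Printing Implicit Defensive.
Import Order.TTheory GRing.Theory Num.Theory.
Local Open Scope ring_scope.

Section KyFanSubdifferential.
Variable C : numClosedFieldType.

(** * Conjugate transposes and completion to a unitary matrix *)

Lemma adjmxE m p (X : 'M[C]_(m, p)) i j : adjmx X i j = (X j i)^*.
Proof. by rewrite !mxE. Qed.

Lemma adjmxK m p (X : 'M[C]_(m, p)) : adjmx (adjmx X) = X.
Proof. by apply/matrixP=> i j; rewrite !adjmxE conjCK. Qed.

Lemma adjmxM m p q (X : 'M[C]_(m, p)) (Y : 'M[C]_(p, q)) :
  adjmx (X *m Y) = adjmx Y *m adjmx X.
Proof. by rewrite /adjmx map_mxM trmx_mul. Qed.

Lemma adjmxB m p (X Y : 'M[C]_(m, p)) : adjmx (X - Y) = adjmx X - adjmx Y.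
Proof. by apply/matrixP=> i j; rewrite !mxE rmorphB. Qed.

Lemma adjmx1 m : adjmx (1%:M : 'M[C]_m) = 1%:M.
Proof. by rewrite /adjmx map_mx1 trmx1. Qed.

Lemma adjmx_diag m (d : 'rV[C]_m) :
  (forall i, 0 <= d 0 i) -> adjmx (diag_mx d) = diag_mx d.
Proof.
move=> d0; apply/matrixP=> i j; rewrite adjmxE !mxE eq_sym.
by case: eqP => [->|]; rewrite ?mulr1n ?mulr0n ?conjC0 ?geC0_conj.
Qed.

Lemma adjmx_mulE m p q (X : 'M[C]_(m, p)) (Y : 'M[C]_(m, q)) i j :
  (adjmx X *m Y) i j = \sum_l (X l i)^* * Y l j.
Proof. by rewrite mxE; apply: eq_bigr => l _; rewrite adjmxE. Qed.

Lemma adjmx_mul_diag m p (X : 'M[C]_(m, p)) i :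
  (adjmx X *m X) i i = \sum_l `|X l i| ^+ 2.
Proof. by rewrite adjmx_mulE; apply: eq_bigr => l _; rewrite normCKC. Qed.

Lemma adjmx_mul_diag_ge0 m p (X : 'M[C]_(m, p)) i : 0 <= (adjmx X *m X) i i.
Proof. by rewrite adjmx_mul_diag sumr_ge0 // => l _; rewrite exprn_ge0. Qed.

Lemma mulmx_diag_adjE m p q (X : 'M[C]_(m, q)) (d : 'rV[C]_q) (Y : 'M[C]_(p, q)) i j :
  (X *m diag_mx d *m adjmx Y) i j = \sum_l d 0 l * (X i l * (Y j l)^*).
Proof.
rewrite mul_mx_diag mxE; apply: eq_bigr => l _.
by rewrite mxE adjmxE mulrAC mulrC.
Qed.

Lemma unitary_mulmxV m (U : 'M[C]_m) : adjmx U *m U = 1%:M -> U *m adjmx U = 1%:M.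
Proof. exact: mulmx1C. Qed.

(** Induction on the number of columns outside [D]. Zeroing one of them makes the matrix singular;
    the conjugate of a left null vector, once normalised, is orthogonal to every column in [D] and
    fills the vacant place. *)
Lemma unitary_extend m (D : {set 'I_m}) (w : 'M[C]_m) :
  {in D &, forall i j, (adjmx w *m w) i j = (i == j)%:R} ->
  exists2 W : 'M[C]_m, adjmx W *m W = 1%:M & {in D, forall j, col j W = col j w}.
Proof.
have [r] := ubnP #|~: D|; elim: r => // r IHr in D w *; rewrite ltnS => leDr wD.
have [i iD|fullD] := pickP [pred i | i \notin D]; last first.
  have inD j : j \in D by move: (fullD j) => /= /negbFE.
  by exists w => //; apply/matrixP=> i j; rewrite wD // mxE.
pose w0 := \matrix_(l, j) if j == i then 0 else w l j.
have /det0P[x x0 xw0] : \det w0 == 0.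
  rewrite (expand_det_col _ i) big1 // => l _.
  by rewrite mxE eqxx mul0r.
pose N := \sum_l `|x 0 l| ^+ 2.
have N0 : 0 < N.
  rewrite lt_neqAle sumr_ge0 ?andbT => [|l _]; last by rewrite exprn_ge0.
  apply: contra x0 => /eqP/esym/psumr_eq0P-/(_ (fun l _ => exprn_ge0 _ (normr_ge0 _))) xl.
  apply/eqP/rowP=> l; rewrite mxE; apply/eqP.
  by have /eqP := xl l isT; rewrite expf_eq0 normr_eq0.
pose w1 := \matrix_(l, j) if j == i then (x 0 l)^* / sqrtC N else w l j.
have sN : (sqrtC N)^* = sqrtC N by rewrite geC0_conj // sqrtC_ge0 ltW.
have orth b : b \in D -> \sum_l x 0 l * w l b = 0.
  move=> bD; have /rowP/(_ b) := xw0; rewrite !mxE => {2}<-.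
  apply: eq_bigr => l _; rewrite mxE; case: eqP => // bi.
  by move: iD; rewrite /= -bi bD.
have ltDr : (#|~: (i |: D)| < r)%N.
  apply: leq_trans leDr; rewrite proper_card // setCU properIr //.
  by apply/subsetPn; exists i; rewrite !inE // eqxx.
have [|W WU Ww] := IHr (i |: D) w1 ltDr.
- move=> a b; rewrite !inE => aD bD; rewrite adjmx_mulE.
  have [ai|ai] := eqVneq a i; have [bi|bi] := eqVneq b i.
  + subst a b; rewrite eqxx.
    transitivity (N / (sqrtC N ^+ 2)); last by rewrite sqrtCK divff ?gt_eqF.
    rewrite mulr_suml; apply: eq_bigr => l _.
    by rewrite !mxE eqxx rmorphM /= fmorphV /= conjCK sN normCK expr2 invfM mulrACA.
  + subst a; move: bD; rewrite (negPf bi) /= => bD; rewrite eq_sym (negPf bi) /=.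
    transitivity ((sqrtC N)^-1 * \sum_l x 0 l * w l b); last by rewrite orth // mulr0.
    rewrite mulr_sumr; apply: eq_bigr => l _.
    by rewrite !mxE eqxx (negPf bi) rmorphM /= fmorphV /= conjCK sN mulrAC mulrC.
  + subst b; move: aD; rewrite (negPf ai) /= => aD.
    transitivity ((\sum_l x 0 l * w l a)^* / sqrtC N); last first.
      by rewrite orth // conjC0 mul0r.
    rewrite rmorph_sum mulr_suml; apply: eq_bigr => l _.
    by rewrite !mxE eqxx (negPf ai) rmorphM /= mulrA (mulrC (w l a)^*).
  + move: aD bD; rewrite (negPf ai) (negPf bi) /= => aD bD.
    rewrite -wD // adjmx_mulE; apply: eq_bigr => l _.
    by rewrite !mxE (negPf ai) (negPf bi).
- exists W => // j jD; rewrite Ww ?inE ?jD ?orbT //.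
  apply/colP=> l; rewrite !mxE; case: eqP => // ji.
  by move: iD; rewrite /= -ji jD.
Qed.

(** * Singular values and the singular value decomposition *)

Lemma char_poly_unitary_conj n (Q D : 'M[C]_n) :
  adjmx Q *m Q = 1%:M -> char_poly (Q *m D *m adjmx Q) = char_poly D.
Proof.
move=> QU; have QV := unitary_mulmxV QU.
have mapQ : map_mx polyC Q *m map_mx polyC (adjmx Q) = 1%:M.
  by rewrite -map_mxM QV map_mx1.
rewrite /char_poly /char_poly_mx !map_mxM /=.
suff -> : 'X%:M - map_mx polyC Q *m map_mx polyC D *m map_mx polyC (adjmx Q)
  = map_mx polyC Q *m ('X%:M - map_mx polyC D) *m map_mx polyC (adjmx Q).
  by rewrite !det_mulmx mulrAC -det_mulmx mapQ det1 mul1r.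
by rewrite mulmxBr mulmxBl scalar_mxC -[X in _ = X - _]mulmxA mapQ mulmx1.
Qed.

(** [gram_eigs] comes from some splitting of the characteristic polynomial, so its order is unknown;
    uniqueness of the factorisation into linear factors compares it with any diagonalisation. *)
Lemma perm_gram_eigs n (A Q : 'M[C]_n) (d : 'rV[C]_n) :
  adjmx Q *m Q = 1%:M -> adjmx A *m A = Q *m diag_mx d *m adjmx Q ->
  perm_eq (gram_eigs A) [seq d 0 i | i <- enum 'I_n].
Proof.
move=> QU AE; rewrite /gram_eigs; case: closed_field_poly_normal => r /=.
rewrite (monicP (char_poly_monic _)) scale1r AE char_poly_unitary_conj //.
rewrite char_poly_trig ?diag_mx_is_trig // => rE.
apply: prod_XsubC_eq; rewrite -rE big_map big_enum /=.
by apply: eq_bigr => i _; rewrite mxE eqxx.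
Qed.

Lemma gram_svd n (A P Q : 'M[C]_n) (s : 'rV[C]_n) :
  adjmx P *m P = 1%:M -> (forall i, 0 <= s 0 i) ->
  A = P *m diag_mx s *m adjmx Q ->
  adjmx A *m A = Q *m diag_mx (\row_i s 0 i ^+ 2) *m adjmx Q.
Proof.
move=> PU s0 ->; rewrite !adjmxM adjmxK adjmx_diag // !mulmxA.
rewrite -(mulmxA _ (adjmx P) P) PU mulmx1; congr (_ *m _).
by rewrite -mulmxA mulmx_diag.
Qed.

Lemma sv_svd n (A P Q : 'M[C]_n) (s : 'rV[C]_n) :
    adjmx P *m P = 1%:M -> adjmx Q *m Q = 1%:M ->
    (forall i, 0 <= s 0 i) -> (forall i j : 'I_n, (i <= j)%N -> s 0 j <= s 0 i) ->
    A = P *m diag_mx s *m adjmx Q ->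
  forall i : 'I_n, sv i A = s 0 i.
Proof.
move=> PU QU s0 sdec AE i.
pose ss := [seq s 0 i | i <- enum 'I_n].
have perm_ss : perm_eq ss [seq sqrtC z | z <- gram_eigs A].
  rewrite perm_sym.
  have /(perm_map sqrtC)/perm_trans-> // := perm_gram_eigs QU (gram_svd PU s0 AE).
  rewrite -map_comp; apply/seq.permP=> p; congr count; apply: eq_map => j /=.
  by rewrite mxE sqrCK.
have ss0 : all (fun x => 0 <= x) ss by apply/allP=> _ /mapP[j _ ->].
have sizess : size ss = n by rewrite size_map size_enum_ord.
have nthss (j : 'I_n) : nth 0 ss j = s 0 j.
  by rewrite (nth_map j) ?size_enum_ord // nth_ord_enum.
have ss_sorted : sorted (fun x y : C => y <= x) ss.
  apply/(sortedP 0) => j; rewrite sizess => ltj.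
  by rewrite (nthss (Ordinal (ltnW ltj))) (nthss (Ordinal ltj)) sdec /=.
suff -> : sv i A = nth 0 ss i by [].
rewrite /sv /sing_vals; congr nth.
have ge_trans : transitive (fun x y : C => y <= x).
  by move=> y x z yx zy; apply: le_trans zy yx.
rewrite -[RHS](sorted_sort ge_trans ss_sorted).
(* The order of [C] is only partial; sorting is canonical here because nonnegative numbers are
   pairwise comparable. *)
apply/esym/perm_sort_inP => //.
- move=> x y /(allP ss0) x0 /(allP ss0) y0.
  by rewrite orbC real_leVge // ger0_real.
- by move=> y x z _ _ _; apply: ge_trans.
- by move=> x y _ _; rewrite andbC => /le_anti.
Qed.

Lemma gram_diag_sorted n (A : 'M[C]_n) : exists Q (d : 'rV[C]_n),
  [/\ adjmx Q *m Q = 1%:M, forall i, 0 <= d 0 i,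
      forall i j : 'I_n, (i <= j)%N -> d 0 j <= d 0 i
    & adjmx A *m A = Q *m diag_mx d *m adjmx Q].
Proof.
pose H := adjmx A *m A.
have adjE (X : 'M[C]_n) : map_mx Num.conj X^T = adjmx X.
  by rewrite /adjmx map_trmx.
have /orthomx_spectralP : H \is normalmx.
  by apply/normalmxP; rewrite adjE /H adjmxM adjmxK.
have := spectral_unitarymx H; set U := spectralmx H; set d := spectral_diag H.
move=> UU; rewrite invmx_unitary // adjE => HE.
have {}UU : U *m adjmx U = 1%:M by rewrite -adjE; apply/unitarymxP.
(* Each eigenvalue is the squared length of a column of [A *m adjmx U], hence nonnegative. *)
have dE i : d 0 i = (adjmx (A *m adjmx U) *m (A *m adjmx U)) i i.
  rewrite adjmxM adjmxK -mulmxA (mulmxA _ A) -/H HE !mulmxA UU mul1mx.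
  by rewrite -mulmxA UU mulmx1 mxE eqxx.
have d0 i : 0 <= d 0 i by rewrite dE adjmx_mul_diag_ge0.
pose ge := fun x y : C => y <= x.
pose t := [tuple d 0 i | i < n].
have [|p pE] := @tuple_permP _ _ (sort ge t) t _; first by rewrite perm_sort.
have t0 : all (fun x => 0 <= x) t by apply/allP=> _ /mapP[j _ ->].
have sorted_t : sorted ge (sort ge t).
  apply: (sort_sorted_in _ t0) => x y x0 y0.
  by rewrite /ge orbC real_leVge // ger0_real.
(* The eigenvectors are permuted by the permutation [p] that sorts the eigenvalues. *)
exists (\matrix_(i, j) adjmx U i (p j)), (\row_i d 0 (p i)).
have nthp (i : 'I_n) : nth 0 (sort ge t) i = d 0 (p i).
  by rewrite pE (nth_map i) ?size_enum_ord // nth_ord_enum tnth_mktuple.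
split=> [|i|i j leij|].
- apply/matrixP=> i j; rewrite adjmx_mulE.
  transitivity ((adjmx (adjmx U) *m adjmx U) (p i) (p j)).
    by rewrite adjmx_mulE; apply: eq_bigr => l _; rewrite !mxE.
  by rewrite adjmxK UU !mxE (inj_eq perm_inj).
- by rewrite mxE.
- rewrite !mxE -!nthp.
  apply: (sorted_leq_nth _ _ 0 sorted_t) => //; rewrite ?inE ?size_sort ?size_tuple //.
    by move=> y x z; rewrite /ge => yx zy; apply: le_trans zy yx.
  by move=> x; rewrite /ge.
- apply/matrixP=> i j; rewrite -/H HE -[U in _ *m U]adjmxK !mulmx_diag_adjE.
  by rewrite (reindex_inj (@perm_inj _ p)); apply: eq_bigr => l _; rewrite !mxE.
Qed.

(** The columns of [A *m Q] are orthogonal with squared lengths [d 0 j]; normalising the nonzero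
    ones and completing them to a unitary matrix gives [P]. *)
Lemma svd n (A : 'M[C]_n) : exists P Q (s : 'rV[C]_n),
  [/\ adjmx P *m P = 1%:M, adjmx Q *m Q = 1%:M, forall i, 0 <= s 0 i,
      forall i j : 'I_n, (i <= j)%N -> s 0 j <= s 0 i
    & A = P *m diag_mx s *m adjmx Q].
Proof.
have [Q [d [QU d0 ddec AE]]] := gram_diag_sorted A.
pose s := \row_i sqrtC (d 0 i).
have s0 i : 0 <= s 0 i by rewrite mxE sqrtC_ge0.
pose V := A *m Q.
have VV i j : (adjmx V *m V) i j = (i == j)%:R * d 0 i.
  rewrite adjmxM mulmxA -(mulmxA _ _ A) AE !mulmxA QU mul1mx.
  by rewrite -mulmxA QU mulmx1 mxE mulrC mulr_natr.
(* Where [s 0 j = 0] the quotient is 0 by convention; these columns lie outside the set that the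
   completion preserves. *)
pose w := \matrix_(l, j) (V l j / s 0 j).
have [|P PU Pw] := @unitary_extend n [set i | d 0 i != 0] w.
  move=> i j; rewrite !inE => di dj; rewrite adjmx_mulE.
  transitivity ((adjmx V *m V) i j / (s 0 i * s 0 j)).
    rewrite adjmx_mulE mulr_suml; apply: eq_bigr => l _.
    rewrite [w _ _]mxE [w _ j]mxE rmorphM /= fmorphV /= (geC0_conj (s0 i)).
    by rewrite invfM mulrACA.
  rewrite VV; case: eqP => [<-|_]; last by rewrite !mul0r.
  by rewrite mul1r mxE -expr2 sqrtCK divff.
exists P, Q, s; split=> // [i j leij|].
  by rewrite !mxE ler_sqrtC ?qualifE/= ?ddec.
suff VE : V = P *m diag_mx s by rewrite -VE -mulmxA (unitary_mulmxV QU) mulmx1.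
apply/matrixP=> l j; rewrite mul_mx_diag mxE.
have [dj|dj] := eqVneq (d 0 j) 0.
  rewrite [s _ _]mxE dj sqrtC0 mulr0.
  have := VV j j; rewrite dj mulr0 adjmx_mul_diag.
  move/psumr_eq0P => /(_ (fun _ _ => exprn_ge0 _ (normr_ge0 _)) l isT)/eqP.
  by rewrite expf_eq0 normr_eq0 => /eqP.
have /colP/(_ l) : col j P = col j w by apply: Pw; rewrite inE.
rewrite !mxE => ->.
by rewrite mulfVK // sqrtC_eq0.
Qed.

(** * Ky Fan's inequality for pairs of isometries *)

Lemma kyfan_svd n k (A P Q : 'M[C]_n) (s : 'rV[C]_n) :
    adjmx P *m P = 1%:M -> adjmx Q *m Q = 1%:M ->
    (forall i, 0 <= s 0 i) -> (forall i j : 'I_n, (i <= j)%N -> s 0 j <= s 0 i) ->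
    A = P *m diag_mx s *m adjmx Q -> (k <= n)%N ->
  kyfan k A = \sum_(j < n | (j < k)%N) s 0 j.
Proof.
move=> PU QU s0 sdec AE lekn.
rewrite /kyfan (big_ord_widen _ (fun i => sv i A) lekn).
by apply: eq_bigr => j _; exact: (sv_svd PU QU s0 sdec AE).
Qed.

(** [K] is an orthogonal projection, hence so is [1 - K], and the diagonal of [1 - K] consists of
    squared column norms. *)
Lemma coisometry_diag_le1 k n (M : 'M[C]_(k, n)) j :
  M *m adjmx M = 1%:M -> (adjmx M *m M) j j <= 1.
Proof.
move=> MM; set K := adjmx M *m M.
have KK : K *m K = K by rewrite /K mulmxA -(mulmxA (adjmx M)) MM mulmx1.
have KH : adjmx K = K by rewrite /K adjmxM adjmxK.
have := adjmx_mul_diag_ge0 (1%:M - K) j.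
rewrite adjmxB adjmx1 KH mulmxBl mul1mx mulmxBr mulmx1 KK subrr subr0 !mxE eqxx.
by rewrite subr_ge0 ?mxE.
Qed.

Lemma trace_coisometry k n (M : 'M[C]_(k, n)) :
  M *m adjmx M = 1%:M -> \sum_j (adjmx M *m M) j j = k%:R.
Proof. by move=> MM; rewrite -[LHS]/(\tr _) mxtrace_mulC MM mxtrace1. Qed.

Lemma Re_mulC (x y : C) :
  'Re (x * y^*) = (`|x| ^+ 2 + `|y| ^+ 2) / 2 - `|x - y| ^+ 2 / 2.
Proof. by rewrite ReE !normCK !rmorphM !rmorphB /= conjCK; field. Qed.

(** Polarising each [Re (M_ij conj N_ij)] separates the averaged squared column norms from the
    defect [|M_ij - N_ij|^2], so that the equality case can be read off. *)
Lemma Re_trace_svd n k (X Y : 'M[C]_(n, k)) (A P Q : 'M[C]_n) (s : 'rV[C]_n)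
    (M := adjmx X *m P) (N := adjmx Y *m Q) :
    (forall i, 0 <= s 0 i) -> A = P *m diag_mx s *m adjmx Q ->
  pairing (X *m adjmx Y) A
    = \sum_j s 0 j * (((adjmx M *m M) j j + (adjmx N *m N) j j) / 2)
      - \sum_j s 0 j * ((\sum_i `|M i j - N i j| ^+ 2) / 2).
Proof.
move=> s0 ->; rewrite /pairing adjmxM adjmxK -mulmxA mxtrace_mulC.
have -> : adjmx X *m (P *m diag_mx s *m adjmx Q) *m Y = M *m diag_mx s *m adjmx N.
  by rewrite /N adjmxM adjmxK !mulmxA.
rewrite /mxtrace raddf_sum -sumrB.
under eq_bigr => i _ do rewrite mulmx_diag_adjE raddf_sum /=.
rewrite exchange_big; apply: eq_bigr => j _.
rewrite !adjmx_mul_diag -mulrBr -big_split /= !mulr_suml -sumrB mulr_sumr.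
by apply: eq_bigr => i _; rewrite ReMl ?ger0_real // Re_mulC.
Qed.

(* The Abel-type identity behind both the inequality and its equality case:
   for [sigma = s_k] every summand on the right is nonnegative. *)
Lemma kyfan_gap n k (X Y : 'M[C]_(n, k)) (A P Q : 'M[C]_n) (s : 'rV[C]_n) sigma
    (M := adjmx X *m P) (N := adjmx Y *m Q) :
    adjmx X *m X = 1%:M -> adjmx Y *m Y = 1%:M ->
    adjmx P *m P = 1%:M -> adjmx Q *m Q = 1%:M ->
    (forall i, 0 <= s 0 i) -> (forall i j : 'I_n, (i <= j)%N -> s 0 j <= s 0 i) ->
    A = P *m diag_mx s *m adjmx Q -> (k <= n)%N ->
  kyfan k A - pairing (X *m adjmx Y) A
    = \sum_j (s 0 j - sigma) *
        ((j < k)%N%:R - ((adjmx M *m M) j j + (adjmx N *m N) j j) / 2)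
      + \sum_j s 0 j * ((\sum_i `|M i j - N i j| ^+ 2) / 2).
Proof.
move=> XX YY PU QU s0 sdec AE lekn.
rewrite (Re_trace_svd X Y s0 AE) -/M -/N (kyfan_svd PU QU s0 sdec AE lekn).
rewrite opprB addrA addrAC; congr (_ + _).
have sum0 : \sum_(j < n) ((j < k)%N%:R
    - ((adjmx M *m M) j j + (adjmx N *m N) j j) / 2) = 0 :> C.
  rewrite sumrB -mulr_suml big_split /= !trace_coisometry; first last.
  - by rewrite /M adjmxM adjmxK mulmxA -(mulmxA _ P) (unitary_mulmxV PU) mulmx1.
  - by rewrite /N adjmxM adjmxK mulmxA -(mulmxA _ Q) (unitary_mulmxV QU) mulmx1.
  rewrite -natr_sum -big_mkcond /= sum1_card.
  rewrite -sum1_card -(big_ord_widen _ (fun=> 1%N) lekn) sum1_card card_ord.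
  by field.
(* Both weight systems have total [k], so a multiple [sigma] of their zero difference can be
   inserted, turning [s_j] into [s_j - sigma]. *)
rewrite -[RHS]addr0 -[X in _ = _ + X](mulr0 sigma) -[X in _ * X]sum0 mulr_sumr.
rewrite -big_split /= big_mkcond -sumrB; apply: eq_bigr => j _ /=.
by case: (j < k)%N => /=; ring.
Qed.

Lemma coisometry_mul k n (X : 'M[C]_(n, k)) (P : 'M[C]_n) :
  adjmx X *m X = 1%:M -> P *m adjmx P = 1%:M ->
  (adjmx X *m P) *m adjmx (adjmx X *m P) = 1%:M.
Proof. by move=> XX PP; rewrite adjmxM adjmxK mulmxA -(mulmxA _ P) PP mulmx1. Qed.

(** Both factors change sign at the same place: they are nonnegative for [j < k] and nonpositive
    from [k] on, as [s 0 i0] is the [k]-th entry of [s] counted from one. *)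
Lemma kyfan_gap_ge0 n k (s : 'rV[C]_n) (i0 : 'I_n) (a b : 'I_n -> C) :
    (forall i j : 'I_n, (i <= j)%N -> s 0 j <= s 0 i) -> i0.+1 = k ->
    (forall j, 0 <= a j <= 1) -> (forall j, 0 <= b j <= 1) ->
  forall j, 0 <= (s 0 j - s 0 i0) * ((j < k)%N%:R - (a j + b j) / 2).
Proof.
move=> sdec i0k a01 b01 j; have [/andP[a0 a1] /andP[b0 b1]] := (a01 j, b01 j).
have [ltjk|lekj] := ltnP j k.
  apply: mulr_ge0; first by rewrite subr_ge0 sdec // -ltnS i0k.
  by rewrite subr_ge0 ler_pdivrMr ?ltr0n // mul1r (_ : 2 = 1 + 1) // lerD.
apply: mulr_le0; first by rewrite subr_le0 sdec // ltnW ?i0k.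
by rewrite sub0r oppr_le0 divr_ge0 ?addr_ge0.
Qed.

Lemma kyfan_ge n k (X Y : 'M[C]_(n, k)) (A : 'M[C]_n) :
    (1 <= k <= n)%N -> adjmx X *m X = 1%:M -> adjmx Y *m Y = 1%:M ->
  pairing (X *m adjmx Y) A <= kyfan k A.
Proof.
move=> /andP[k0 kn] XX YY; have [P [Q [s [PU QU s0 sdec AE]]]] := svd A.
have ltk : (k.-1 < n)%N by rewrite prednK.
rewrite -subr_ge0 (kyfan_gap (s 0 (Ordinal ltk)) XX YY PU QU s0 sdec AE kn).
have cM := coisometry_mul XX (unitary_mulmxV PU).
have cN := coisometry_mul YY (unitary_mulmxV QU).
apply: addr_ge0; apply: sumr_ge0 => j _.
  pose M1 := adjmx X *m P; pose N1 := adjmx Y *m Q.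
  apply: (kyfan_gap_ge0 (a := fun i => (adjmx M1 *m M1) i i)
    (b := fun i => (adjmx N1 *m N1) i i) sdec) => [|i|i] /=; first by rewrite prednK.
  - by rewrite adjmx_mul_diag_ge0 coisometry_diag_le1.
  - by rewrite adjmx_mul_diag_ge0 coisometry_diag_le1.
by rewrite mulr_ge0 // divr_ge0 // sumr_ge0 // => i _; rewrite exprn_ge0.
Qed.

(** * The equality case *)

Lemma normsq_eq0 k n (M : 'M[C]_(k, n)) j :
  (adjmx M *m M) j j = 0 -> forall i, M i j = 0.
Proof.
rewrite adjmx_mul_diag => /psumr_eq0P H i.
have /eqP := H (fun _ _ => exprn_ge0 _ (normr_ge0 _)) i isT.
by rewrite expf_eq0 normr_eq0 => /eqP.
Qed.

(** A unit vector whose projection onto the range of [X] still has length 1 lies in that range: the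
    Gram matrix of the residual [P - X M] is [1 - M^H M]. *)
Lemma isometry_col_range n k (X : 'M[C]_(n, k)) (P : 'M[C]_n) j
    (M := adjmx X *m P) :
    adjmx X *m X = 1%:M -> adjmx P *m P = 1%:M -> (adjmx M *m M) j j = 1 ->
  forall l, (X *m M) l j = P l j.
Proof.
move=> XX PP M1 l; apply/eqP; rewrite eq_sym -subr_eq0; apply/eqP.
have -> : P l j - (X *m M) l j = (P - X *m M) l j by rewrite !mxE.
apply: normsq_eq0.
have -> : adjmx (P - X *m M) *m (P - X *m M) = 1%:M - adjmx M *m M.
  rewrite adjmxB [adjmx (X *m M)]adjmxM mulmxBl !mulmxBr PP !mulmxA.
  rewrite -(mulmxA _ (adjmx X) X) XX mulmx1.
  have -> : adjmx P *m X = adjmx M by rewrite /M adjmxM adjmxK.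
  by rewrite -(mulmxA _ (adjmx X) P) -/M subrr subr0.
by rewrite mxE [X in _ + X]mxE M1 mxE eqxx subrr.
Qed.

Lemma sum_cols_mul m p q (U : 'M[C]_(m, q)) (V : 'M[C]_(p, q)) :
  \sum_i col i U *m adjmx (col i V) = U *m adjmx V.
Proof.
apply/matrixP=> i j; rewrite summxE mxE; apply: eq_bigr => l _.
by rewrite mxE big_ord1 !mxE.
Qed.

(* With [S' = diag (s_j - sigma)^+] one gets [A Y = X (sigma + M S' M^H)], and the
   columns of [W] are eigenvectors of [M S' M^H]. *)
Lemma kyfan_eq_half n k (kn : (k <= n)%N) (X Y : 'M[C]_(n, k)) (A P Q : 'M[C]_n)
    (s : 'rV[C]_n) sigma (W : 'M[C]_k) (M := adjmx X *m P) (N := adjmx Y *m Q) :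
    adjmx X *m X = 1%:M -> adjmx W *m W = 1%:M -> P *m adjmx P = 1%:M ->
    (forall i, 0 <= s 0 i) -> 0 <= sigma ->
    A = P *m diag_mx s *m adjmx Q ->
    (forall j, sigma < s 0 j -> (adjmx M *m M) j j = 1) ->
    (forall j, s 0 j < sigma -> (adjmx M *m M) j j = 0) ->
    (forall j, s 0 j < sigma -> (adjmx N *m N) j j = 0) ->
    (forall i j, s 0 j != 0 -> M i j = N i j) ->
    (forall j : 'I_n, sigma < s 0 j -> (j < k)%N) ->
    (forall i : 'I_k, sigma <= s 0 (widen_ord kn i)) ->
    (forall i : 'I_k, sigma < s 0 (widen_ord kn i) ->
       col i W = col (widen_ord kn i) M) ->
  forall i : 'I_k,
    A *m (Y *m col i W) = s 0 (widen_ord kn i) *: (X *m col i W).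
Proof.
move=> XX WW PP s0 sig0 AE M1 M0 N0 MN ltk lesig WM i.
pose S' := \row_j (if sigma < s 0 j then s 0 j - sigma else 0).
have sigR : sigma \is Num.real by rewrite ger0_real.
have sR j : s 0 j \is Num.real by rewrite ger0_real.
have AY : A *m Y = P *m (sigma *: adjmx M + diag_mx S' *m adjmx M).
  have -> : A *m Y = P *m (diag_mx s *m adjmx N).
    by rewrite AE /N adjmxM adjmxK !mulmxA.
  congr (_ *m _); apply/matrixP=> j l; rewrite !mul_diag_mx [LHS]mxE [RHS]mxE.
  rewrite [X in _ = X + _]mxE [X in _ = _ + X]mxE [S' _ _]mxE !adjmxE -mulrDl.
  have [ltj|] := boolP (sigma < s 0 j).
    by rewrite addrC subrK MN // gt_eqF // (le_lt_trans sig0).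
  (* At a tie [s_j = sigma] the entry of [S'] is 0. If [sigma = 0] the rows of [M] and [N] may
     differ, but both sides vanish. *)
  rewrite addr0 -real_leNgt // le_eqVlt => /orP[/eqP sE|ltj].
    rewrite sE; have [->|nz] := eqVneq sigma 0; first by rewrite !mul0r.
    by rewrite MN ?sE.
  by rewrite (normsq_eq0 (M0 j ltj)) (normsq_eq0 (N0 j ltj)) conjC0 !mulr0.
(* [S'] keeps only the columns with [s_j > sigma], and these columns of [P] lie in the range of
   [X]. *)
have PS : P *m diag_mx S' = X *m M *m diag_mx S'.
  apply/matrixP=> l j; rewrite !mul_mx_diag !mxE.
  case: ifP => [ltj|_]; last by rewrite !mulr0.
  by have := isometry_col_range XX (mulmx1C PP) (M1 _ ltj) l; rewrite mxE => ->.
have PM : P *m adjmx M = X by rewrite /M adjmxM adjmxK mulmxA PP mul1mx.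
have -> : A *m (Y *m col i W)
  = sigma *: (X *m col i W) + X *m (M *m diag_mx S' *m adjmx M *m col i W).
  rewrite mulmxA AY mulmxDr -scalemxAr PM mulmxDl -scalemxAl !mulmxA.
  by rewrite PS /M !mulmxA.
(* A column of [W] with [s_i > sigma] is the matching column of [M]; the others are orthogonal to
   all of these and are killed, in accordance with [S'_i = 0]. *)
have -> : M *m diag_mx S' *m adjmx M *m col i W
    = S' 0 (widen_ord kn i) *: col i W.
  have orth j : sigma < s 0 j ->
      (adjmx M *m col i W) j 0 = (j == widen_ord kn i)%:R.
    move=> ltj; have jk := ltk _ ltj.
    have jE : j = widen_ord kn (Ordinal jk) by apply: val_inj.
    transitivity ((adjmx W *m W) (Ordinal jk) i); last first.
      by rewrite WW mxE -!val_eqE.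
    rewrite !adjmx_mulE; apply: eq_bigr => l _; rewrite [col _ _ _ _]mxE.
    have /colP/(_ l) : col (Ordinal jk) W = col j M.
      by rewrite WM -?jE.
    by rewrite !mxE => ->.
  rewrite -mulmxA; apply/colP=> l; rewrite mul_mx_diag mxE.
  rewrite (bigD1 (widen_ord kn i)) //= big1 ?addr0 => [|j /negPf ji].
    rewrite [in LHS]mxE !mxE; case: ifP => lti; last by rewrite mulr0 !mul0r.
    have := orth _ lti; rewrite mxE eqxx => ->; rewrite mulr1 mulrC.
    by have /colP/(_ l) := WM _ lti; rewrite !mxE => ->.
  rewrite [in LHS]mxE [S' 0 j]mxE; case: ifP => ltj; last by rewrite mulr0 mul0r.
  by rewrite orth // ji mulr0.
rewrite -scalemxAr -scalerDl; congr (_ *: _); rewrite mxE.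
case: ifP => [_|/negbT]; first by rewrite addrC subrK.
by rewrite -real_leNgt // addr0 => lei; apply/le_anti; rewrite lesig.
Qed.

Lemma kyfan_eq_gen2 n k (X Y : 'M[C]_(n, k)) (A : 'M[C]_n) :
    (1 <= k <= n)%N -> adjmx X *m X = 1%:M -> adjmx Y *m Y = 1%:M ->
    pairing (X *m adjmx Y) A = kyfan k A ->
  gen2 k A (X *m adjmx Y).
Proof.
move=> /andP[k0 kn] XX YY eqA; have [P [Q [s [PU QU s0 sdec AE]]]] := svd A.
have PP := unitary_mulmxV PU; have QQ := unitary_mulmxV QU.
have ltk : (k.-1 < n)%N by rewrite prednK.
pose i0 := Ordinal ltk; pose sigma := s 0 i0.
pose M := adjmx X *m P; pose N := adjmx Y *m Q.
have M01 j : 0 <= (adjmx M *m M) j j <= 1.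
  by rewrite adjmx_mul_diag_ge0 coisometry_diag_le1 // coisometry_mul.
have N01 j : 0 <= (adjmx N *m N) j j <= 1.
  by rewrite adjmx_mul_diag_ge0 coisometry_diag_le1 // coisometry_mul.
have i0k : i0.+1 = k by rewrite /= prednK.
pose a j := (adjmx M *m M) j j; pose b j := (adjmx N *m N) j j.
have ge1 := kyfan_gap_ge0 (a := a) (b := b) sdec i0k M01 N01.
have ge2 j : 0 <= s 0 j * ((\sum_i `|M i j - N i j| ^+ 2) / 2).
  by rewrite mulr_ge0 // divr_ge0 // sumr_ge0 // => i _; rewrite exprn_ge0.
have := kyfan_gap sigma XX YY PU QU s0 sdec AE kn.
rewrite eqA subrr -/M -/N => /esym/eqP.
rewrite paddr_eq0 ?sumr_ge0 // => /andP[/eqP eq1 /eqP eq2].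
have {}eq1 j := psumr_eq0P (fun j _ => ge1 j) eq1 (i := j) isT.
have {}eq2 j := psumr_eq0P (fun j _ => ge2 j) eq2 (i := j) isT.
have MN i j : s 0 j != 0 -> M i j = N i j.
  move=> sj; have /eqP := eq2 j.
  rewrite mulf_eq0 (negPf sj) /= mulf_eq0 invr_eq0 pnatr_eq0 orbF => /eqP.
  move=> /psumr_eq0P => /(_ (fun _ _ => exprn_ge0 _ (normr_ge0 _)) i isT)/eqP.
  by rewrite expf_eq0 normr_eq0 subr_eq0 => /eqP.
have ltjk j : sigma < s 0 j -> (j < k)%N.
  move=> sj; rewrite ltnNge; apply: contraTN sj => kj.
  have /le_gtF-> // : s 0 j <= sigma by apply: sdec; rewrite (leq_trans _ kj) ?leq_pred.
have gekj j : s 0 j < sigma -> (j < k)%N = false.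
  move=> sj; apply: contraTF sj => jk.
  have /le_gtF-> // : sigma <= s 0 j by apply: sdec; rewrite -ltnS i0k.
(* Away from ties the first factor of the gap is nonzero, so [a j + b j] is 2 or 0; as both numbers
   lie in [[0, 1]], each is then determined. *)
have ab j : s 0 j != sigma -> a j + b j = 2 * (j < k)%N%:R.
  rewrite -subr_eq0 => sj; have /eqP := eq1 j.
  rewrite mulf_eq0 (negPf sj) /= subr_eq0 => /eqP ->.
  by rewrite mulrC divfK ?pnatr_eq0.
have ab0 j : s 0 j < sigma -> a j = 0 /\ b j = 0.
  move=> sj; have /eqP := ab j (negbT (lt_eqF sj)).
  have [/andP[a0 _] /andP[b0 _]] := (M01 j, N01 j).
  by rewrite gekj // mulr0 paddr_eq0 // => /andP[/eqP ? /eqP ?].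
have ab1 j : sigma < s 0 j -> a j = 1 /\ b j = 1.
  move=> sj; have := ab j (negbT (gt_eqF sj)).
  have [/andP[_ a1] /andP[_ b1]] := (M01 j, N01 j).
  rewrite ltjk // mulr1 => ab2.
  have /eqP : (1 - a j) + (1 - b j) = 0.
    by rewrite addrACA -opprD ab2 (_ : 1 + 1 = 2) // subrr.
  by rewrite paddr_eq0 ?subr_ge0 // !subr_eq0 => /andP[/eqP <- /eqP <-].
have lesig (i : 'I_k) : sigma <= s 0 (widen_ord kn i).
  by apply: sdec; rewrite -ltnS i0k /=.
(* The columns [M_j] with [s_j > sigma] are orthonormal because the isometry [X] sends them to the
   columns [P_j]; their indices are all below [k]. *)
have [|W WW WM] := @unitary_extend k [set i | sigma < s 0 (widen_ord kn i)]
    (\matrix_(l, i) M l (widen_ord kn i)).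
  move=> i j; rewrite !inE => si sj.
  pose i' := widen_ord kn i; pose j' := widen_ord kn j.
  transitivity ((adjmx M *m M) i' j').
    by rewrite !adjmx_mulE; apply: eq_bigr => l _; congr (_^* * _); rewrite [LHS]mxE.
  have XM l : sigma < s 0 l -> X *m col l M = col l P.
    move=> sl; apply/colP=> h; rewrite [RHS]mxE.
    rewrite -(isometry_col_range XX PU (ab1 l sl).1) !mxE.
    by apply: eq_bigr => g _; rewrite [col _ _ _ _]mxE.
  transitivity ((adjmx (col i' P) *m col j' P) 0 0).
    rewrite -!XM // adjmxM mulmxA -(mulmxA _ (adjmx X) X) XX mulmx1 !adjmx_mulE.
    by apply: eq_bigr => l _; rewrite [col i' M _ _]mxE [col j' M _ _]mxE.
  transitivity ((adjmx P *m P) i' j'); last by rewrite PU mxE -val_eqE.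
  by rewrite !adjmx_mulE; apply: eq_bigr => l _; congr (_^* * _); rewrite [LHS]mxE.
have {}WM (i : 'I_k) : sigma < s 0 (widen_ord kn i) -> col i W = col (widen_ord kn i) M.
  move=> si; rewrite WM ?inE //; apply/colP=> l.
  by rewrite [LHS]mxE [LHS]mxE [RHS]mxE.
have WN (i : 'I_k) : sigma < s 0 (widen_ord kn i) -> col i W = col (widen_ord kn i) N.
  move=> si; rewrite WM //; apply/colP=> l; rewrite [LHS]mxE [RHS]mxE MN //.
  by rewrite gt_eqF ?(le_lt_trans (s0 i0) si).
have svE (i : 'I_k) : sv i A = s 0 (widen_ord kn i).
  exact: (sv_svd PU QU s0 sdec AE (widen_ord kn i)).
have AE' : adjmx A = Q *m diag_mx s *m adjmx P.
  by rewrite AE !adjmxM adjmxK adjmx_diag // mulmxA.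
exists (fun i => X *m col i W), (fun i => Y *m col i W).
have on (Z : 'M[C]_(n, k)) : adjmx Z *m Z = 1%:M ->
    Defs.orthonormal (fun i : 'I_k => Z *m col i W).
  move=> ZZ i j; rewrite adjmxM mulmxA -(mulmxA _ _ Z) ZZ mulmx1.
  apply/matrixP=> x y; rewrite !ord1 [RHS]mxE eqxx mulr1n.
  transitivity ((adjmx W *m W) i j); last by rewrite WW mxE.
  by rewrite !adjmx_mulE; apply: eq_bigr => l _; congr (_^* * _); rewrite [LHS]mxE.
split; [exact: on|exact: on| |].
- move=> i; rewrite svE; split.
    apply: (kyfan_eq_half XX WW PP s0 (s0 i0) AE) => //.
    + by move=> j /ab1[].
    + by move=> j /ab0[].
    + by move=> j /ab0[].
  (* The adjoint relation is the same statement for [A^H], with [(X, P)] and [(Y, Q)] exchanged. *)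
  apply: (kyfan_eq_half YY WW QQ s0 (s0 i0) AE') => //.
  + by move=> j /ab1[].
  + by move=> j /ab0[].
  + by move=> j /ab0[].
  + by move=> x j /MN ->.
(* Both isometries are multiplied by the same unitary [W], which cancels in the product
   [X W W^H Y^H]. *)
- under eq_bigr => i _ do rewrite adjmxM mulmxA -(mulmxA X).
  rewrite -mulmx_suml -mulmx_sumr sum_cols_mul (unitary_mulmxV WW).
  by rewrite mulmx1.
Qed.

(** * Generators are subgradients *)

Lemma gen2_gen1 n k (A G : 'M[C]_n) : gen2 k A G -> gen1 k A G.
Proof. by move=> [u [v [ou ov uv ->]]]; exists u, v; split=> // i; case: (uv i). Qed.

Lemma cols_orthonormal n k (u : 'I_k -> 'cV[C]_n) (U := \matrix_(l, i) u i l 0) :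
  Defs.orthonormal u -> adjmx U *m U = 1%:M.
Proof.
move=> ou; apply/matrixP=> i j; have /matrixP/(_ 0 0) := ou i j.
rewrite !adjmx_mulE !mxE eqxx mulr1n => <-.
by apply: eq_bigr => l _; rewrite !mxE.
Qed.

Lemma gen1_isometry n k (A G : 'M[C]_n) : gen1 k A G ->
  exists X Y : 'M[C]_(n, k), [/\ adjmx X *m X = 1%:M, adjmx Y *m Y = 1%:M,
    G = X *m adjmx Y & A *m Y = X *m diag_mx (\row_i sv i A)].
Proof.
move=> [u [v [ou ov Av ->]]].
exists (\matrix_(l, i) u i l 0), (\matrix_(l, i) v i l 0); split.
- exact: cols_orthonormal.
- exact: cols_orthonormal.
- rewrite -sum_cols_mul; apply: eq_bigr => i _.
  by congr (_ *m adjmx _); apply/colP=> l; rewrite !mxE.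
- apply/matrixP=> l i; rewrite mul_mx_diag !mxE.
  have /colP/(_ l) := Av i; rewrite !mxE mulrC => <-.
  by apply: eq_bigr => j _; rewrite !mxE.
Qed.

Lemma sv_ge0 n (A : 'M[C]_n) (i : 'I_n) : 0 <= sv i A.
Proof.
have [P [Q [s [PU QU s0 sdec AE]]]] := svd A.
by rewrite (sv_svd PU QU s0 sdec AE).
Qed.

Lemma pairingD n (G X Y : 'M[C]_n) : pairing G (X + Y) = pairing G X + pairing G Y.
Proof. by rewrite /pairing mulmxDr !raddfD. Qed.

Lemma pairingN n (G X : 'M[C]_n) : pairing G (- X) = - pairing G X.
Proof. by rewrite /pairing mulmxN !raddfN. Qed.

Lemma pairing_suml n m (c : 'I_m -> C) (P : 'I_m -> 'M[C]_n) Y :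
  (forall j, 0 <= c j) ->
  pairing (\sum_j c j *: P j) Y = \sum_j c j * pairing (P j) Y.
Proof.
move=> c0; rewrite /pairing.
have -> : adjmx (\sum_j c j *: P j) = \sum_j c j *: adjmx (P j).
  apply/matrixP=> a b; rewrite adjmxE !summxE rmorph_sum.
  by apply: eq_bigr => j _; rewrite !mxE rmorphM /= geC0_conj.
rewrite mulmx_suml linear_sum raddf_sum /=; apply: eq_bigr => j _.
by rewrite -scalemxAl mxtraceZ ReMl ?ger0_real.
Qed.

(** The pairing with [G] is bounded by the norm everywhere, by [kyfan_ge], and attains it at [A],
    where it is the trace of [X^H A Y = diag(s_1, ..., s_k)]. *)
Lemma gen1_subdiff n k (A G : 'M[C]_n) : (1 <= k <= n)%N ->
  gen1 k A G -> subdiff (kyfan k) A G.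
Proof.
move=> kn /gen1_isometry[X [Y [XX YY -> AY]]] Z.
rewrite pairingD pairingN lerB ?kyfan_ge //.
rewrite /pairing adjmxM adjmxK mxtrace_mulC mulmxA AY mxtrace_mulC mulmxA XX mul1mx.
rewrite mxtrace_diag raddf_sum /kyfan ler_sum // => i _.
have /andP[_ lekn] := kn.
by rewrite mxE /= (Creal_ReP _ _) // ger0_real // (sv_ge0 A (widen_ord lekn i)).
Qed.

Lemma conv_subdiff n k (A G : 'M[C]_n) : (1 <= k <= n)%N ->
  conv (gen1 k A) G -> subdiff (kyfan k) A G.
Proof.
move=> kn [m [c [P [c0 c1 SP ->]]]] Y; rewrite pairing_suml //.
rewrite -[leRHS]mul1r -c1 mulr_suml ler_sum // => j _.
by rewrite ler_wpM2l // gen1_subdiff.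
Qed.

(** * Boxes and hypersimplices as hulls of their vertices *)

Definition convex (V : lmodType C) (K : V -> Prop) :=
  forall t x y, 0 <= t <= 1 -> K x -> K y -> K (t *: x + (1 - t) *: y).

Lemma conv_convex n (S : 'M[C]_n -> Prop) : convex (conv S).
Proof.
move=> t _ _ /andP[t0 t1] [m [c [P [c0 c1 SP ->]]]] [p [d [Q [d0 d1 SQ ->]]]].
exists (m + p)%N.
exists (fun j => match split j with inl a => t * c a | inr b => (1 - t) * d b end).
exists (fun j => match split j with inl a => P a | inr b => Q b end).
split.
- by move=> j; case: split => a; rewrite mulr_ge0 ?subr_ge0.
- rewrite big_split_ord /=.
  under eq_bigr => i _ do rewrite (unsplitK (inl _ i)).
  under [X in _ + X]eq_bigr => i _ do rewrite (unsplitK (inr _ i)).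
  by rewrite -!mulr_sumr c1 d1 !mulr1 addrC subrK.
- by move=> j; case: split.
- rewrite big_split_ord /= !scaler_sumr; congr (_ + _); apply: eq_bigr => i _.
    by rewrite (unsplitK (inl _ i)) scalerA.
  by rewrite (unsplitK (inr _ i)) scalerA.
Qed.

Definition set_coord n (v : 'rV[C]_n) i x : 'rV[C]_n :=
  \row_j if j == i then x else v 0 j.

(** Induction on the number of coordinates strictly inside their interval: such a coordinate is a
    convex combination of its two endpoints, the others being fixed. *)
Lemma box_convex n (K : 'rV[C]_n -> Prop) (e : 'rV[C]_n) : convex K ->
    (forall v : 'rV_n, (forall i, v 0 i = e 0 i \/ v 0 i = - e 0 i) -> K v) ->
  forall v : 'rV_n, (forall i, - e 0 i <= v 0 i <= e 0 i) -> K v.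
Proof.
move=> Kc Ke v.
pose bad (v : 'rV[C]_n) := [set i | (v 0 i != e 0 i) && (v 0 i != - e 0 i)].
have [r] := ubnP #|bad v|; elim: r v => // r IHr v; rewrite ltnS => ler ve.
have [v0|[i iv]] := set_0Vmem (bad v).
  apply: Ke => i; have /setP/(_ i) := v0; rewrite !inE -negb_or => /negbFE.
  by case/orP => /eqP; [left|right].
have set_bad x : x = e 0 i \/ x = - e 0 i -> (#|bad (set_coord v i x)| < r)%N.
  move=> xe; apply: leq_trans ler; apply: proper_card; apply/properP; split.
    apply/subsetP=> j; rewrite !inE !mxE; have [->|//] := eqVneq j i.
    by case: xe => ->; rewrite eqxx ?andbF.
  by exists i => //; rewrite !inE !mxE eqxx; case: xe => ->; rewrite eqxx ?andbF.
have /andP[vi1 vi2] := ve i.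
have e0 : 0 < e 0 i.
  rewrite lt_neqAle; apply/andP; split; last first.
    by rewrite -(@pmulrn_lge0 _ _ 2) // mulr2n -{2}[e 0 i]opprK subr_ge0 (le_trans vi1).
  apply: contraTN iv => /eqP e0; move: vi1 vi2; rewrite !inE -e0 oppr0 => v1 v2.
  by have -> : v 0 i = 0 by [apply/le_anti; rewrite v1 v2]; rewrite eqxx.
have Kx x : x = e 0 i \/ x = - e 0 i -> K (set_coord v i x).
  move=> xe; apply: IHr; first exact: set_bad.
  move=> j; rewrite mxE; case: eqP => // ->.
  have ge : - e 0 i <= e 0 i by apply: le_trans vi2.
  by case: xe => ->; rewrite lexx ?ge ?andbT.
pose t := (v 0 i + e 0 i) / (2 * e 0 i).
have e2 : 0 < 2 * e 0 i by rewrite mulr_gt0.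
have -> : v = t *: set_coord v i (e 0 i) + (1 - t) *: set_coord v i (- e 0 i).
  apply/rowP=> j; rewrite !mxE; case: eqP => [->|_]; last by ring.
  by rewrite /t; field; rewrite gt_eqF.
apply: Kc; [|apply: Kx; by left|apply: Kx; by right].
apply/andP; split; first by rewrite divr_ge0 ?(ltW e2) // -lerBlDr sub0r.
by rewrite ler_pdivrMr // mul1r mulr_natl mulr2n lerD.
Qed.

(** Since the sum is an integer, a fractional coordinate never comes alone. Moving mass between two
    of them, in either direction, until one becomes 0 or 1 puts [v] on a segment whose ends have
    fewer fractional coordinates. *)
Lemma hypersimplex_convex n k (K : 'rV[C]_n -> Prop) : convex K ->
    (forall v : 'rV_n, (forall i, v 0 i = 0 \/ v 0 i = 1) ->
       \sum_i v 0 i = k%:R -> K v) ->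
  forall v : 'rV_n, (forall i, 0 <= v 0 i <= 1) -> \sum_i v 0 i = k%:R -> K v.
Proof.
move=> Kc K01 v; pose bad (v : 'rV[C]_n) := [set i | (v 0 i != 0) && (v 0 i != 1)].
have [r] := ubnP #|bad v|; elim: r v => // r IHr v; rewrite ltnS => ler v01 sumv.
have [v0|[i iv]] := set_0Vmem (bad v).
  apply: K01 => // i; have /setP/(_ i) := v0; rewrite !inE -negb_or => /negbFE.
  by case/orP => /eqP; [left|right].
have frac l : l \in bad v -> 0 < v 0 l < 1.
  rewrite !inE => /andP[l0 l1]; have /andP[ge0 le1] := v01 l.
  by rewrite !lt_neqAle ge0 le1 l1 eq_sym l0.
have [j jv ji] : exists2 j, j \in bad v & j != i.
  apply/exists_inP; apply: contraT => /exists_inPn alone.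
  have v01E l : l != i -> v 0 l = (v 0 l == 1)%:R.
    move=> li; have := alone l; rewrite li => lb.
    have : l \notin bad v by apply/negP=> /lb.
    by rewrite inE -negb_or negbK => /orP[] /eqP ->; rewrite ?eqxx // eq_sym oner_eq0.
  have /andP[vi0 vi1] := frac i iv.
  (* If [i] were the only fractional coordinate, [v 0 i = k - m] would be an integer strictly
     between 0 and 1. *)
  pose m := (\sum_(l | l != i) (v 0 l == 1)%R)%N.
  have vE : v 0 i + m%:R = k%:R.
    rewrite -sumv (bigD1 i) //= natr_sum; congr (_ + _).
    by apply: eq_bigr => l /v01E.
  have ltmk : (m < k)%N by rewrite -(ltr_nat C) -vE ltrDr.
  move: vi1; rewrite -(ltrD2r m%:R) vE nat1r ltr_nat ltnS.
  by rewrite leqNgt ltmk.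
have [/andP[vi0 vi1] /andP[vj0 vj1]] := (frac i iv, frac j jv).
pose sh t := set_coord (set_coord v i (v 0 i + t)) j (v 0 j - t).
have shK t : 0 <= v 0 i + t <= 1 -> 0 <= v 0 j - t <= 1 ->
    (v 0 i + t \in [:: 0; 1]) || (v 0 j - t \in [:: 0; 1]) -> K (sh t).
  move=> ti tj hit; apply: IHr.
  - apply: leq_trans ler; apply: proper_card; apply/properP; split.
      apply/subsetP=> l; rewrite inE !mxE.
      by have [-> //|_] := eqVneq l j; have [-> //|_] := eqVneq l i; rewrite inE.
    move: hit; rewrite !inE => /orP[] hit; [exists i|exists j] => //.
      by rewrite inE !mxE [i == j]eq_sym (negPf ji) eqxx -negb_or negbK.
    by rewrite inE !mxE eqxx -negb_or negbK.
  - by move=> l; rewrite !mxE; case: ifP => // _; case: ifP.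
  - rewrite -sumv (bigD1 j) //= (bigD1 i) 1?eq_sym //=.
    rewrite [RHS](bigD1 j) //= [X in _ = _ + X](bigD1 i) 1?eq_sym //=.
    rewrite !mxE [i == j]eq_sym (negPf ji) !eqxx !addrA; congr (_ + _); first by ring.
    apply: eq_bigr => l /andP[lj li].
    by rewrite !mxE (negPf lj) (negPf li).
have [viR vjR] : v 0 i \is Num.real /\ v 0 j \is Num.real by rewrite !gtr0_real.
have vi1R : 1 - v 0 i \is Num.real by rewrite rpredB ?rpred1.
have vj1R : 1 - v 0 j \is Num.real by rewrite rpredB ?rpred1.
(* The longest admissible shift towards [i] is the smaller of [1 - v_i] and [v_j]; in the other
   direction it is the smaller of [v_i] and [1 - v_j]. *)
have [a [a0 Ka]] : exists a, 0 < a /\ K (sh a).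
  have [le|/ltW le] := @real_leP _ (1 - v 0 i) (v 0 j) vi1R vjR.
    exists (1 - v 0 i); split; first by rewrite subr_gt0.
    have E : v 0 i + (1 - v 0 i) = 1 by rewrite addrC subrK.
    apply: shK; rewrite ?E ?ler01 ?lexx ?inE ?eqxx ?orbT //.
    by rewrite subr_ge0 le lerBlDr (le_trans (ltW vj1)) // lerDl subr_ge0 ltW.
  exists (v 0 j); split=> //; apply: shK; rewrite ?subrr ?lexx ?ler01 ?inE ?eqxx ?orbT //.
  by rewrite (addr_ge0 (ltW vi0) (ltW vj0)) /= addrC -lerBrDr.
have [b [b0 Kb]] : exists b, 0 < b /\ K (sh (- b)).
  have [le|/ltW le] := @real_leP _ (v 0 i) (1 - v 0 j) viR vj1R.
    exists (v 0 i); split=> //; apply: shK; rewrite ?subrr ?lexx ?ler01 ?inE ?eqxx //.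
    by rewrite opprK (addr_ge0 (ltW vj0) (ltW vi0)) /= addrC -lerBrDr.
  exists (1 - v 0 j); split; first by rewrite subr_gt0.
  have E : v 0 j + (1 - v 0 j) = 1 by rewrite addrC subrK.
  apply: shK; rewrite ?opprK ?E ?ler01 ?lexx ?inE ?eqxx ?orbT //.
  by rewrite subr_ge0 le lerBlDr (le_trans (ltW vi1)) // lerDl subr_ge0 ltW.
(* The weights make the shifts [a] and [-b] cancel. *)
have -> : v = (b / (a + b)) *: sh a + (1 - b / (a + b)) *: sh (- b).
  have ab : a + b != 0 by rewrite gt_eqF ?addr_gt0.
  apply/rowP=> l; rewrite !mxE; have [->|_] := eqVneq l j; first by field.
  by have [->|_] := eqVneq l i; field.
apply: Kc => //; rewrite divr_ge0 ?addr_ge0 ?(ltW a0) ?(ltW b0) //=.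
by rewrite ler_pdivrMr ?addr_gt0 // mul1r lerDr (ltW a0).
Qed.

(** * Convex combinations of rank-[k] partial isometries *)

Definition isometry_pair n k (G : 'M[C]_n) := exists X Y : 'M[C]_(n, k),
  [/\ adjmx X *m X = 1%:M, adjmx Y *m Y = 1%:M & G = X *m adjmx Y].

(** The unimodular entries of [e] are absorbed into the columns of [X] indexed by [S]; the remaining
    columns drop out. *)
Lemma isometry_pair_sub n (X Y : 'M[C]_n) (e : 'rV[C]_n) (S : {set 'I_n}) :
    adjmx X *m X = 1%:M -> adjmx Y *m Y = 1%:M ->
    (forall i, i \in S -> `|e 0 i| = 1) -> (forall i, i \notin S -> e 0 i = 0) ->
  isometry_pair #|S| (X *m diag_mx e *m adjmx Y).
Proof.
move=> XX YY e1 e0; pose f (i : 'I_#|S|) := enum_val i.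
exists (\matrix_(l, i) (X l (f i) * e 0 (f i))), (\matrix_(l, i) Y l (f i)); split.
- apply/matrixP=> i j; rewrite adjmx_mulE.
  transitivity ((e 0 (f i))^* * e 0 (f j) * (adjmx X *m X) (f i) (f j)).
    rewrite adjmx_mulE mulr_sumr; apply: eq_bigr => l _.
    by rewrite !mxE rmorphM /=; ring.
  rewrite XX !mxE (inj_eq enum_val_inj); case: eqP => [<-|_]; last by rewrite mulr0.
  by rewrite mulr1 -normCKC e1 ?enum_valP // expr1n.
- apply/matrixP=> i j; rewrite adjmx_mulE.
  transitivity ((adjmx Y *m Y) (f i) (f j)).
    by rewrite adjmx_mulE; apply: eq_bigr => l _; rewrite !mxE.
  by rewrite YY !mxE (inj_eq enum_val_inj).
- apply/matrixP=> a b; rewrite mulmx_diag_adjE mxE.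
  rewrite (bigID (mem S)) /= [X in _ + X]big1 ?addr0 => [|i iS]; last first.
    by rewrite e0 // mul0r.
  by rewrite big_enum_val /=; apply: eq_bigr => i _; rewrite !mxE mulrCA mulrA.
Qed.

(** The vector [d] is raised to some [e >= d] with entries in [[0, 1]] and sum exactly [k]. Then [d]
    lies in the box between [-e] and [e], and [e] in the hypersimplex, whose vertices with signs
    give isometry pairs. *)
Lemma conv_isometry_pair n k (X Y : 'M[C]_n) (d : 'rV[C]_n) : (k <= n)%N ->
    adjmx X *m X = 1%:M -> adjmx Y *m Y = 1%:M ->
    (forall i, 0 <= d 0 i <= 1) -> \sum_i d 0 i <= k%:R ->
  conv (isometry_pair k) (X *m diag_mx d *m adjmx Y).
Proof.
move=> kn XX YY d01 dk.
(* [t] solves [D + t (n - D) = k]. If [D = n], division by zero gives [t = 0], which is right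
   because then [k = n]. *)
pose D := \sum_i d 0 i; pose t := (k%:R - D) / (n%:R - D).
have dn : D <= n%:R by rewrite (le_trans dk) ?ler_nat.
have t01 : 0 <= t <= 1.
  rewrite /t divr_ge0 ?subr_ge0 //=; have [->|nD] := eqVneq (n%:R - D) 0.
    by rewrite invr0 mulr0 ler01.
  by rewrite ler_pdivrMr ?mul1r ?lerD2r ?ler_nat // lt_neqAle eq_sym nD subr_ge0.
have /andP[t0 t1] := t01.
pose e : 'rV[C]_n := \row_i (d 0 i + t * (1 - d 0 i)).
have esum : \sum_i e 0 i = k%:R.
  transitivity (D + t * (n%:R - D)).
    under eq_bigr => i _ do rewrite mxE.
    rewrite big_split -mulr_sumr sumrB /= sumr_const card_ord.
    by [].
  have [nD|nD] := eqVneq (n%:R - D) 0; last by rewrite divfK // addrC subrK.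
  rewrite nD mulr0 addr0; apply/le_anti; rewrite dk /=.
  by move/eqP: nD; rewrite subr_eq0 => /eqP <-; rewrite ler_nat.
have de i : d 0 i <= e 0 i.
  by have /andP[_ d1] := d01 i; rewrite mxE lerDl mulr_ge0 ?subr_ge0.
have e01 i : 0 <= e 0 i <= 1.
  have /andP[d0 d1] := d01 i; rewrite (le_trans d0 (de i)) mxE /=.
  rewrite -lerBrDl -[leRHS]mul1r ler_wpM2r ?subr_ge0 //.
(* [s] is all ones for the box step and the sign pattern of a box vertex for the hypersimplex
   step. *)
have linK (s : 'rV[C]_n) : convex (fun v : 'rV[C]_n =>
    conv (isometry_pair k) (X *m diag_mx (\row_i (s 0 i * v 0 i)) *m adjmx Y)).
  move=> r x y r01 Kx Ky.
  have -> : \row_i (s 0 i * (r *: x + (1 - r) *: y) 0 i)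
      = r *: (\row_i (s 0 i * x 0 i)) + (1 - r) *: (\row_i (s 0 i * y 0 i)).
    by apply/rowP=> i; rewrite !mxE; ring.
  rewrite linearP linearZ /= mulmxDr mulmxDl -!scalemxAr -!scalemxAl.
  exact: conv_convex.
have unitK (v : 'rV[C]_n) : \row_i ((const_mx 1 : 'rV[C]_n) 0 i * v 0 i) = v.
  by apply/rowP=> i; rewrite !mxE mul1r.
rewrite -[d]unitK.
apply: (box_convex (linK _) (e := e)) => [v ve|i]; last first.
  have /andP[d0 _] := d01 i; have /andP[ei0 _] := e01 i.
  by rewrite de andbT (le_trans _ d0) // oppr_le0.
pose s : 'rV[C]_n := \row_i if v 0 i == e 0 i then 1 else -1.
have -> : \row_i ((const_mx 1 : 'rV[C]_n) 0 i * v 0 i) = \row_i (s 0 i * e 0 i).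
  apply/rowP=> i; rewrite [LHS]mxE [RHS]mxE [const_mx 1 _ _]mxE [s _ _]mxE mul1r.
  case: eqP => [->|ne]; first by rewrite mul1r.
  by have [//|->] := ve i; rewrite mulN1r.
apply: (hypersimplex_convex (linK s) _ e01 esum) => w w01 wk.
pose S := [set i | w 0 i == 1].
have kS : #|S| = k.
  apply/eqP; rewrite -(eqr_nat C) -wk -sum1_card natr_sum big_mkcond /=.
  apply/eqP; apply: eq_bigr => i _; rewrite inE.
  by case: (w01 i) => ->; rewrite ?eqxx // eq_sym oner_eq0.
exists 1%N, (fun=> 1), (fun=> X *m diag_mx (\row_i (s 0 i * w 0 i)) *m adjmx Y).
split=> // [|j|]; rewrite ?big_ord1 ?scale1r ?ler01 //.
rewrite -kS; apply: isometry_pair_sub => // i; rewrite inE mxE.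
  move=> /eqP ->; rewrite mulr1 mxE; case: eqP => _; by rewrite ?normrN normr1.
by case: (w01 i) => -> ; rewrite ?eqxx ?mulr0.
Qed.

(** * From subgradients to convex combinations of generators *)

Lemma conv_face n k (A G : 'M[C]_n) : (1 <= k <= n)%N ->
    conv (isometry_pair k) G -> pairing G A = kyfan k A ->
  conv (gen2 k A) G.
Proof.
move=> kn [m [c [P [c0 c1 SP GE]]]] GA.
have SPge j : 0 <= kyfan k A - pairing (P j) A.
  by have [X [Y [XX YY ->]]] := SP j; rewrite subr_ge0 kyfan_ge.
(* The weighted gaps are nonnegative with sum zero, so every [P j] of nonzero weight attains
   equality against [A]. *)
have eq0 : \sum_j c j * (kyfan k A - pairing (P j) A) = 0.
  rewrite (eq_bigr (fun j => c j * kyfan k A - c j * pairing (P j) A)).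
    by rewrite sumrB -mulr_suml c1 mul1r -pairing_suml // -GE GA subrr.
  by move=> j _; rewrite mulrBr.
have P2 j : c j != 0 -> gen2 k A (P j).
  move=> cj.
  have /eqP := psumr_eq0P (fun j _ => mulr_ge0 (c0 j) (SPge j)) eq0 (i := j) isT.
  rewrite mulf_eq0 (negPf cj) subr_eq0 /= => /eqP/esym.
  by have [X [Y [XX YY ->]]] := SP j; apply: kyfan_eq_gen2.
(* Points of weight zero need not be generators; they are replaced by a fixed [P j0] of nonzero
   weight. *)
have [j0 cj0] : exists j, c j != 0.
  apply/existsP; apply: contraT => /existsPn c00.
  by have := oner_neq0 C; rewrite -c1 big1 ?eqxx // => j _; apply/eqP/negbNE/c00.
exists m, c, (fun j => if c j == 0 then P j0 else P j); split=> // [j|].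
  by have [_|cj] := eqVneq (c j) 0; apply: P2.
rewrite GE; apply: eq_bigr => j _.
by have [->|//] := eqVneq (c j) 0; rewrite !scale0r.
Qed.

Lemma kyfan_diag n k (X Y : 'M[C]_n) (s : 'rV[C]_n) :
    (k <= n)%N -> adjmx X *m X = 1%:M -> adjmx Y *m Y = 1%:M ->
    (forall i, 0 <= s 0 i) -> (forall i j : 'I_n, (i <= j)%N -> s 0 j <= s 0 i) ->
  kyfan k (X *m diag_mx s *m adjmx Y) = \sum_(j < n | (j < k)%N) s 0 j.
Proof. by move=> kn XX YY s0 sdec; apply: kyfan_svd XX YY s0 sdec _ kn. Qed.

Lemma kyfanZ n k (a : C) (A : 'M[C]_n) :
  (k <= n)%N -> 0 <= a -> kyfan k (a *: A) = a * kyfan k A.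
Proof.
move=> kn a0; have [P [Q [s [PU QU s0 sdec ->]]]] := svd A.
rewrite scalemxAl scalemxAr -linearZ /= !kyfan_diag ?mulr_sumr //.
- by apply: eq_bigr => j _; rewrite mxE.
- by move=> i; rewrite mxE mulr_ge0.
- by move=> i j ij; rewrite !mxE ler_wpM2l ?sdec.
Qed.

(** By homogeneity, the subgradient inequality at [2 A] and at [0] gives the two halves of the
    equality at [A]. *)
Lemma subdiff_kyfan n k (A G : 'M[C]_n) : (k <= n)%N -> subdiff (kyfan k) A G ->
  pairing G A = kyfan k A /\ forall Y, pairing G Y <= kyfan k Y.
Proof.
move=> kn GA; have GAA : pairing G A = kyfan k A.
  apply/le_anti/andP; split.
    have := GA (2 *: A); rewrite kyfanZ // scaler_nat mulr2n addrK.
    by rewrite mulr_natl mulr2n addrK.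
  have := GA (0 *: A); rewrite kyfanZ // mul0r scale0r !sub0r pairingN.
  by rewrite lerN2.
split=> // Y; have := GA Y.
by rewrite pairingD pairingN GAA lerD2r.
Qed.

Lemma pairing_diag n (X Y : 'M[C]_n) (d e : 'rV[C]_n) :
    adjmx X *m X = 1%:M -> adjmx Y *m Y = 1%:M ->
    (forall i, 0 <= d 0 i) -> (forall i, 0 <= e 0 i) ->
  pairing (X *m diag_mx d *m adjmx Y) (X *m diag_mx e *m adjmx Y)
    = \sum_i d 0 i * e 0 i.
Proof.
move=> XX YY d0 e0; rewrite /pairing !adjmxM adjmxK adjmx_diag //.
rewrite -!mulmxA mxtrace_mulC !mulmxA -(mulmxA _ (adjmx X)) XX mulmx1.
rewrite -!mulmxA YY mulmx1 mulmx_diag mxtrace_diag raddf_sum.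
apply: eq_bigr => i _; rewrite mxE /=.
by apply: Creal_ReP; rewrite rpredM ?ger0_real.
Qed.

Lemma subdiff_conv n k (A G : 'M[C]_n) : (1 <= k <= n)%N ->
  subdiff (kyfan k) A G -> conv (gen2 k A) G.
Proof.
move=> kn1; have /andP[k0 kn] := kn1 => /(subdiff_kyfan kn)[GA Gle].
apply: conv_face => //; move: Gle {GA}.
have [X [Y [d [XX YY d0 ddec ->]]]] := svd G => Gle.
apply: conv_isometry_pair => //.
  move=> i; rewrite d0 /=.
  (* Testing on the rank-one matrix of the leading singular pair of [G], whose norm is 1, bounds the
     largest [d_j] by 1. *)
  pose i0 : 'I_n := Ordinal (leq_trans k0 kn).
  pose e : 'rV[C]_n := \row_j (j == i0)%:R.
  have e0 j : 0 <= e 0 j by rewrite mxE ler0n.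
  have edec (a b : 'I_n) : (a <= b)%N -> e 0 b <= e 0 a.
    move=> ab; rewrite !mxE ler_nat; have [bE|//] := eqVneq b i0.
    have -> : a = i0 by apply/val_inj/eqP; rewrite /= -leqn0 -[0%N]/(val i0) -bE.
    by rewrite eqxx.
  have := Gle (X *m diag_mx e *m adjmx Y).
  rewrite pairing_diag // kyfan_diag // (bigD1 i0) //= [X in _ + X <= _]big1.
    rewrite (bigD1 i0) //= [X in _ <= _ + X]big1 => [|j /andP[_ ji]]; last first.
      by rewrite mxE (negPf ji).
    by rewrite mxE eqxx mulr1 !addr0 => /(le_trans _)-> //; apply: ddec.
  by move=> j ji; rewrite mxE (negPf ji) mulr0.
(* Testing on the unitary matrix [X Y^H], whose norm is [k], bounds the sum of the [d_j]. *)
have := Gle (X *m diag_mx (const_mx 1) *m adjmx Y).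
have m1 i : (const_mx 1 : 'rV[C]_n) 0 i = 1 by rewrite mxE.
have m0 i : 0 <= (const_mx 1 : 'rV[C]_n) 0 i by rewrite m1.
have mdec (i j : 'I_n) : (i <= j)%N ->
  (const_mx 1 : 'rV[C]_n) 0 j <= (const_mx 1 : 'rV[C]_n) 0 i by rewrite !m1.
rewrite pairing_diag // kyfan_diag //.
under eq_bigr => i _ do rewrite m1 mulr1.
under [X in _ <= X]eq_bigr => i _ do rewrite m1.
by rewrite -(big_ord_widen _ (fun=> 1) kn) sumr_const card_ord.
Qed.

End KyFanSubdifferential.

Theorem theorem2 (C : numClosedFieldType) (n k : nat) (A : 'M[C]_n) :
  (1 <= k <= n)%N ->
  (forall G : 'M[C]_n, subdiff (@kyfan C n k) A G <-> conv (gen1 k A) G) /\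
  (forall G : 'M[C]_n, subdiff (@kyfan C n k) A G <-> conv (gen2 k A) G).
Proof.
move=> kn; have sub G : conv (gen2 k A) G -> conv (gen1 k A) G.
  move=> [m [c [P [c0 c1 SP GE]]]]; exists m, c, P; split=> // j.
  exact: gen2_gen1.
by split=> G; split=> [/(subdiff_conv kn)|] //; [exact: sub|exact: conv_subdiff|
  move=> /sub; exact: conv_subdiff].
Qed.
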